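(* Let $\beta\ge0$ and let $M_n=\sum_{i=1}^n\sigma(i)$ be the magnetization under the Ising measure $\mathbb{I}_{0,\beta}$ (zero external field). Then $M_n/n^{1/4}$ converges in the complex mod-Gaussian sense with parameters $t_n=n^{1/2}e^{2\beta}$ and limiting function $\psi(z)=\exp\!\big(-\tfrac{3e^{6\beta}-e^{2\beta}}{24}z^4\big)$, i.e. $$\mathbb{E}_{0,\beta}\!\left[e^{zM_n/n^{1/4}}\right]e^{-n^{1/2}e^{2\beta}z^2/2}\longrightarrow \exp\!\Big(-\tfrac{3e^{6\beta}-e^{2\beta}}{24}z^4\Big)$$ locally uniformly for $z$ in compact subsets of $\mathbb{C}$.
   Context: The Ising measure $\mathbb{I}_{\alpha,\beta}$ on spin configurations $\sigma:\{1,\dots,n\}\to\{\pm1\}$ gives to $\sigma$ probability proportional to $\exp\big(\alpha\sum_{i=1}^n\sigma(i)+\beta\sum_{i=1}^{n-1}\sigma(i)\sigma(i+1)\big)$; here $\alpha=0$. *)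

(* Defs.v *)
From Stdlib Require Import Reals List.
Import ListNotations.
Open Scope R_scope.

Definition Cpx : Type := (R * R)%type.
Definition RtoC (x : R) : Cpx := (x, 0).
Definition Cadd (u v : Cpx) : Cpx := (fst u + fst v, snd u + snd v).
Definition Csub (u v : Cpx) : Cpx := (fst u - fst v, snd u - snd v).
Definition Cmul (u v : Cpx) : Cpx :=
  (fst u * fst v - snd u * snd v, fst u * snd v + snd u * fst v).
Definition Cscale (r : R) (u : Cpx) : Cpx := (r * fst u, r * snd u).
Definition Cmod (u : Cpx) : R := sqrt (fst u ^ 2 + snd u ^ 2).
Definition Cexp (u : Cpx) : Cpx := (exp (fst u) * cos (snd u), exp (fst u) * sin (snd u)).
Definition Csum (l : list Cpx) : Cpx := fold_right Cadd (RtoC 0) l.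

(* all spin configurations sigma : {1..n} -> {+1,-1}, as lists [sigma 1; ...; sigma n] *)
Fixpoint configs (n : nat) : list (list R) :=
  match n with
  | O => [nil]
  | S m => flat_map (fun s => [1 :: s; -1 :: s]) (configs m)
  end.

Definition magnet (s : list R) : R := fold_right Rplus 0 s.

Fixpoint interaction (s : list R) : R :=
  match s with
  | x :: ((y :: _) as t) => x * y + interaction t
  | _ => 0
  end.

Definition ising_weight (beta : R) (s : list R) : R := exp (beta * interaction s).

Definition ising_Z (beta : R) (n : nat) : R :=
  fold_right Rplus 0 (map (ising_weight beta) (configs n)).

Definition ising_mgf (beta : R) (n : nat) (w : Cpx) : Cpx :=
  Csum (map (fun s => Cscale (ising_weight beta s / ising_Z beta n)
                             (Cexp (Cscale (magnet s) w)))
            (configs n)).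

Definition modgauss_term (beta : R) (n : nat) (z : Cpx) : Cpx :=
  Cmul (ising_mgf beta n (Cscale (/ Rpower (INR n) (1/4)) z))
       (Cexp (Cscale (- (Rpower (INR n) (1/2) * exp (2 * beta)) / 2) (Cmul z z))).

Definition psi_lim (beta : R) (z : Cpx) : Cpx :=
  Cexp (Cscale (- (3 * exp (6 * beta) - exp (2 * beta)) / 24)
               (Cmul (Cmul z z) (Cmul z z))).

(* Main.v *)
(** With [q = tanh beta] and [c = cosh w], the transfer matrix gives the recurrence
    [s (n+2) = (1+q) c s (n+1) - q s n], [s 0 = 1], [s 1 = c], for the moment generating
    function [s n = E exp (w M_n)].  For [E = v w^2 / 2 - kappa w^4], [v = e^(2 beta)], the
    number [e^E] solves the characteristic equation up to [O(w^6)].  Hence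
    [r n = s n e^(- n E)] satisfies a recurrence that has the constant [1] as a solution up to
    a defect [O(w^6)], while its other mode is contracted by about [q < 1], so that
    [r n - 1 = O(w + n w^6)].  For [w = z / n^(1/4)] this tends to [0], and [n E] equals
    [n^(1/2) v z^2 / 2 - kappa z^4], which yields the normalization and the limit. *)

From Pilot Require Import Defs.
From Stdlib Require Import Reals List Lra Lia Factorial.
From Coquelicot Require Import Coquelicot.
Open Scope R_scope.

(* [ring] for [C] does not recognize terms whose inferred type is [Cpx]. *)
Ltac as_C_eq := match goal with |- @eq _ ?a ?b => change (@eq C a b) end.

Ltac cring :=
  repeat match goal with
  | |- context [Cexp ?x] =>
      let e := fresh "e" in generalize (Cexp x : C); intro e
  end;
  as_C_eq; ring.

(** * The complex exponential and its Taylor remainder *)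

Lemma Cexp_add (u v : C) : Cexp (u + v)%C = (Cexp u * Cexp v)%C.
Proof.
  unfold Cexp; apply injective_projections; simpl;
    rewrite exp_plus, ?cos_plus, ?sin_plus; ring.
Qed.

Lemma Cexp_0 : Cexp (RtoC 0) = RtoC 1.
Proof.
  unfold Cexp; apply injective_projections; simpl;
    rewrite exp_0, ?cos_0, ?sin_0; ring.
Qed.

Lemma Cexp_opp (u : C) : (Cexp u * Cexp (- u))%C = RtoC 1.
Proof. rewrite <- Cexp_add, <- Cexp_0; f_equal; ring. Qed.

Lemma Cmod_Cexp (u : C) : Cmod (Cexp u) = exp (fst u).
Proof.
  unfold Cmod, Cexp; simpl fst; simpl snd.
  pose proof (sin2_cos2 (snd u)) as H; unfold Rsqr in H.
  replace (_ + _) with (exp (fst u) ^ 2) by nra.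
  apply sqrt_pow2; left; apply exp_pos.
Qed.

Lemma Cmod_Cexp_le (u : C) : Cmod (Cexp u) <= exp (Cmod u).
Proof.
  rewrite Cmod_Cexp.
  assert (H := re_le_Cmod u); unfold Re in H.
  assert (H2 := Rle_abs (fst u)).
  destruct (Rle_lt_or_eq_dec (fst u) (Cmod u)) as [h|h]; [lra| |].
  - left; now apply exp_increasing.
  - rewrite h; lra.
Qed.

(** [N] counts terms: the degree stays below [N], so the remainder [exp_rem N] has order [u^N]. *)
Fixpoint exp_taylor (N : nat) (u : C) : C :=
  match N with
  | O => RtoC 0
  | S k => (exp_taylor k u + RtoC (/ INR (fact k)) * u ^ k)%C
  end.

Definition exp_rem (N : nat) (u : C) : C := (Cexp u - exp_taylor N u)%C.

Lemma exp_taylor_S_0 (N : nat) : exp_taylor (S N) (RtoC 0) = RtoC 1.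
Proof.
  induction N as [|N IH].
  - simpl; rewrite Rinv_1; ring.
  - change (exp_taylor (S (S N)) (RtoC 0))
      with (exp_taylor (S N) (RtoC 0)
            + RtoC (/ INR (fact (S N))) * (RtoC 0 * RtoC 0 ^ N))%C.
    rewrite IH; ring.
Qed.

(* Componentwise, since the mean value theorem below is applied to each component. *)
Definition is_derive_comp (f : R -> C) (t : R) (l : C) : Prop :=
  is_derive (fun s => fst (f s)) t (fst l) /\
  is_derive (fun s => snd (f s)) t (snd l).

Lemma is_derive_comp_minus (f g : R -> C) (t : R) (l m : C) :
  is_derive_comp f t l -> is_derive_comp g t m ->
  is_derive_comp (fun s => (f s - g s)%C) t (l - m)%C.
Proof.
  intros [f1 f2] [g1 g2]; split; simpl.
  - apply (is_derive_minus (fun s => fst (f s)) (fun s => fst (g s))); assumption.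
  - apply (is_derive_minus (fun s => snd (f s)) (fun s => snd (g s))); assumption.
Qed.

Lemma is_derive_comp_plus (f g : R -> C) (t : R) (l m : C) :
  is_derive_comp f t l -> is_derive_comp g t m ->
  is_derive_comp (fun s => (f s + g s)%C) t (l + m)%C.
Proof.
  intros [f1 f2] [g1 g2]; split; simpl.
  - apply (is_derive_plus (fun s => fst (f s)) (fun s => fst (g s))); assumption.
  - apply (is_derive_plus (fun s => snd (f s)) (fun s => snd (g s))); assumption.
Qed.

Lemma is_derive_comp_ext (f g : R -> C) (t : R) (l m : C) :
  (forall s, f s = g s) -> l = m ->
  is_derive_comp f t l -> is_derive_comp g t m.
Proof.
  intros e <- [f1 f2]; split.
  - apply (is_derive_ext (fun s => fst (f s))); [intro; now rewrite e | assumption].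
  - apply (is_derive_ext (fun s => snd (f s))); [intro; now rewrite e | assumption].
Qed.

Lemma is_derive_comp_scal (a : R -> R) (t da : R) (u : C) :
  is_derive a t da -> is_derive_comp (fun s => (RtoC (a s) * u)%C) t (RtoC da * u)%C.
Proof.
  intros H; split; simpl.
  - apply (is_derive_ext (fun s => fst u * a s)); [intro; simpl; ring|].
    replace (da * fst u - 0 * snd u) with (fst u * da) by ring.
    now apply is_derive_scal.
  - apply (is_derive_ext (fun s => snd u * a s)); [intro; simpl; ring|].
    replace (da * snd u + 0 * fst u) with (snd u * da) by ring.
    now apply is_derive_scal.
Qed.

Lemma is_derive_comp_Cexp (u : C) (t : R) :
  is_derive_comp (fun s => Cexp (RtoC s * u)%C) t (u * Cexp (RtoC t * u)%C)%C.
Proof.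
  destruct u as [a b].
  apply is_derive_comp_ext with
    (f := fun s => (exp (s * a) * cos (s * b), exp (s * a) * sin (s * b)))
    (l := Cmult (a, b) (exp (t * a) * cos (t * b), exp (t * a) * sin (t * b))%R).
  - intro s; unfold Cexp; simpl.
    now replace (s * a - 0 * b) with (s * a) by ring;
      replace (s * b + 0 * a) with (s * b) by ring.
  - unfold Cexp; simpl.
    now replace (t * a - 0 * b) with (t * a) by ring;
      replace (t * b + 0 * a) with (t * b) by ring.
  - split; simpl; auto_derive; auto; ring.
Qed.

(** The term [t^k u^k / k!] differentiates to [u] times the preceding term, and the constant term
    drops out, so one term is lost. *)
Lemma is_derive_comp_taylor (N : nat) (u : C) (t : R) :
  is_derive_comp (fun s => exp_taylor (S N) (RtoC s * u)%C) t
    (u * exp_taylor N (RtoC t * u)%C)%C.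
Proof.
  induction N as [|N IH].
  - apply is_derive_comp_ext with (f := fun s => (RtoC ((fun _ => 1) s) * RtoC 1)%C)
      (l := (RtoC 0 * RtoC 1)%C).
    + intro s; simpl; rewrite Rinv_1; ring.
    + simpl; ring.
    + apply (is_derive_comp_scal (fun _ => 1)); apply (is_derive_const (V := R_NormedModule)).
  - apply is_derive_comp_ext with
      (f := fun s => (exp_taylor (S N) (RtoC s * u)
         + RtoC (/ INR (fact (S N)) * s ^ S N) * u ^ S N)%C)
      (l := (u * exp_taylor N (RtoC t * u)
         + RtoC (/ INR (fact N) * t ^ N) * u ^ S N)%C).
    + intro s.
      change (exp_taylor (S (S N)) (RtoC s * u)%C)
      with (exp_taylor (S N) (RtoC s * u)
            + RtoC (/ INR (fact (S N))) * (RtoC s * u) ^ S N)%C.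
      rewrite Cpow_mult_l, RtoC_mult, RtoC_pow; ring.
    + simpl; rewrite Cpow_mult_l, RtoC_mult, RtoC_pow; ring.
    + apply is_derive_comp_plus; [exact IH|].
      apply is_derive_comp_scal.
      replace (/ INR (fact N) * t ^ N)
        with (/ INR (fact (S N)) * (INR (S N) * t ^ N)).
      2:{ rewrite fact_simpl, mult_INR.
          field; split; [apply INR_fact_neq_0 | apply not_0_INR; lia]. }
      apply (is_derive_scal (fun s => s ^ S N)).
      replace (INR (S N) * t ^ N) with (INR (S N) * 1 * t ^ pred (S N)) by (simpl pred; ring).
      apply is_derive_pow, (is_derive_id (K := R_AbsRing)).
Qed.

(** The mean value theorem gives [h t = dh c * t] with [0 <= c <= t], hence [c^N <= t^N].
    Integration would gain a factor [1/(N+1)], but only the order in [t] matters here. *)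
Lemma MVT_monomial_bound (h dh : R -> R) (B : R) (N : nat) :
  0 <= B -> h 0 = 0 -> (forall t, is_derive h t (dh t)) ->
  (forall t, 0 <= t <= 1 -> Rabs (dh t) <= B * t ^ N) ->
  forall t, 0 <= t <= 1 -> Rabs (h t) <= B * t ^ S N.
Proof.
  intros hB h0 hd hb t ht.
  destruct (MVT_gen h 0 t dh) as [c [hc e]].
  - intros; apply hd.
  - intros x _; apply continuity_pt_filterlim.
    apply (ex_derive_continuous (K := R_AbsRing) (V := R_NormedModule) h).
    now exists (dh x).
  - rewrite Rmin_left, Rmax_right in hc by lra.
    rewrite h0, !Rminus_0_r in e; rewrite e, Rabs_mult, (Rabs_pos_eq t) by lra.
    assert (Rabs (dh c) <= B * c ^ N) by (apply hb; lra).
    assert (c ^ N <= t ^ N) by (apply pow_incr; lra).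
    assert (Rabs (dh c) <= B * t ^ N) by nra.
    simpl; nra.
Qed.

Lemma im_le_Cmod (c : C) : Rabs (snd c) <= Cmod c.
Proof. eapply Rle_trans; [apply Rmax_r | apply Rmax_Cmod]. Qed.

Lemma Cmod_le_abs (c : C) : Cmod c <= Rabs (fst c) + Rabs (snd c).
Proof.
  pose proof (Rabs_pos (fst c)); pose proof (Rabs_pos (snd c)).
  unfold Cmod; rewrite <- (sqrt_pow2 (Rabs (fst c) + Rabs (snd c))) by lra.
  apply sqrt_le_1_alt; rewrite <- (pow2_abs (fst c)), <- (pow2_abs (snd c)); nra.
Qed.

(** Induction on [N]: along the segment [t u], the derivative of remainder [N+1] is [u] times
    remainder [N], and remainder [N+1] vanishes at [t = 0]. Each step costs a factor 2, because the
    real and imaginary parts are bounded separately and then added. *)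
Lemma exp_rem_bound_segment (N : nat) (u : C) (t : R) :
  0 <= t <= 1 ->
  Cmod (exp_rem N (RtoC t * u)%C) <= 2 ^ N * exp (Cmod u) * Cmod u ^ N * t ^ N.
Proof.
  pose proof (Cmod_ge_0 u) as hu; pose proof (exp_pos (Cmod u)) as he.
  revert t; induction N as [|N IH]; intros t ht.
  - unfold exp_rem; simpl.
    replace (Cexp (RtoC t * u) - RtoC 0)%C with (Cexp (RtoC t * u)%C) by cring.
    eapply Rle_trans; [apply Cmod_Cexp_le|].
    rewrite Cmod_mult, Cmod_R, Rabs_pos_eq by lra.
    destruct (Rle_lt_or_eq_dec (t * Cmod u) (Cmod u)) as [h|h]; [nra| |].
    + apply exp_increasing in h; lra.
    + rewrite h; lra.
  - set (B := 2 ^ N * exp (Cmod u) * Cmod u ^ S N).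
    assert (hp : 0 <= 2 ^ N) by (apply pow_le; lra).
    assert (hB : 0 <= B).
    { unfold B; repeat apply Rmult_le_pos; try lra; now apply pow_le. }
    assert (hd : forall s, is_derive_comp (fun s => exp_rem (S N) (RtoC s * u)%C) s
                   (u * exp_rem N (RtoC s * u)%C)%C).
    { intro s; unfold exp_rem.
      eapply is_derive_comp_ext; [reflexivity| |apply is_derive_comp_minus;
        [apply is_derive_comp_Cexp | apply is_derive_comp_taylor]].
      cring. }
    assert (hb : forall s, 0 <= s <= 1 ->
              Cmod (u * exp_rem N (RtoC s * u)) <= B * s ^ N).
    { intros s hs; rewrite Cmod_mult; specialize (IH s hs).
      apply Rmult_le_compat_l with (r := Cmod u) in IH; [|exact hu].
      eapply Rle_trans; [exact IH|]. unfold B; simpl; right; ring. }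
    assert (h0 : exp_rem (S N) (RtoC 0 * u)%C = RtoC 0).
    { unfold exp_rem; replace (RtoC 0 * u)%C with (RtoC 0) by cring.
      rewrite exp_taylor_S_0, Cexp_0; cring. }
    assert (h1 : Rabs (fst (exp_rem (S N) (RtoC t * u)%C)) <= B * t ^ S N).
    { refine (MVT_monomial_bound (fun s => fst (exp_rem (S N) (RtoC s * u)%C)) _ B N
               hB _ (fun s => proj1 (hd s)) _ t ht).
      - now rewrite h0.
      - intros s hs; eapply Rle_trans; [apply re_le_Cmod | now apply hb]. }
    assert (h2 : Rabs (snd (exp_rem (S N) (RtoC t * u)%C)) <= B * t ^ S N).
    { refine (MVT_monomial_bound (fun s => snd (exp_rem (S N) (RtoC s * u)%C)) _ B N
               hB _ (fun s => proj2 (hd s)) _ t ht).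
      - now rewrite h0.
      - intros s hs; eapply Rle_trans; [apply im_le_Cmod | now apply hb]. }
    eapply Rle_trans; [apply Cmod_le_abs|].
    unfold B in h1, h2.
    replace (2 ^ S N) with (2 ^ N + 2 ^ N) by (simpl; ring).
    lra.
Qed.

Lemma exp_rem_bound (N : nat) (u : C) :
  Cmod (exp_rem N u) <= 2 ^ N * exp (Cmod u) * Cmod u ^ N.
Proof.
  pose proof (exp_rem_bound_segment N u 1 ltac:(lra)) as H.
  rewrite pow1, Rmult_1_r in H.
  now replace (RtoC 1 * u)%C with u in H by cring.
Qed.

(** * Calculus of orders of vanishing at the origin *)

(** Fixing the disk [|w| <= 1] once for all spares tracking radii through sums and products, and
    makes a higher order imply every lower one. *)
Definition bigO (k : nat) (f : C -> C) : Prop :=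
  exists B, 0 <= B /\ forall w, Cmod w <= 1 -> Cmod (f w) <= B * Cmod w ^ k.

Lemma pow_le_1 (x : R) (n : nat) : 0 <= x <= 1 -> 0 <= x ^ n <= 1.
Proof.
  intros hx; split; [now apply pow_le|].
  rewrite <- (pow1 n); now apply pow_incr.
Qed.

Lemma bigO_const (a : C) : bigO 0 (fun _ => a).
Proof. exists (Cmod a); split; [apply Cmod_ge_0 | intros; simpl; lra]. Qed.

Lemma bigO_id : bigO 1 (fun w => w).
Proof. exists 1; split; [lra | intros; simpl; lra]. Qed.

Lemma bigO_opp (k : nat) (f : C -> C) : bigO k f -> bigO k (fun w => (- f w)%C).
Proof.
  intros [B [hB H]]; exists B; split; [exact hB|].
  intros; rewrite Cmod_opp; auto.
Qed.

Lemma bigO_plus (k : nat) (f g : C -> C) :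
  bigO k f -> bigO k g -> bigO k (fun w => (f w + g w)%C).
Proof.
  intros [B [hB H]] [B' [hB' H']]; exists (B + B'); split; [lra|].
  intros w hw; eapply Rle_trans; [apply Cmod_triangle|].
  specialize (H w hw); specialize (H' w hw); lra.
Qed.

Lemma bigO_mult (j k : nat) (f g : C -> C) :
  bigO j f -> bigO k g -> bigO (j + k) (fun w => (f w * g w)%C).
Proof.
  intros [B [hB H]] [B' [hB' H']]; exists (B * B'); split; [now apply Rmult_le_pos|].
  intros w hw; rewrite Cmod_mult, pow_add.
  replace (B * B' * (Cmod w ^ j * Cmod w ^ k))
    with (B * Cmod w ^ j * (B' * Cmod w ^ k)) by ring.
  apply Rmult_le_compat; auto using Cmod_ge_0.
Qed.

Lemma bigO_weaken (j k : nat) (f : C -> C) : (j <= k)%nat -> bigO k f -> bigO j f.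
Proof.
  intros hjk [B [hB H]]; exists B; split; [exact hB|].
  intros w hw; eapply Rle_trans; [now apply H|].
  apply Rmult_le_compat_l; [exact hB|].
  replace k with (j + (k - j))%nat by lia; rewrite pow_add.
  pose proof (Cmod_ge_0 w).
  pose proof (pow_le (Cmod w) j ltac:(lra)).
  pose proof (pow_le_1 (Cmod w) (k - j) ltac:(lra)); nra.
Qed.

Lemma bigO_minus (k : nat) (f g : C -> C) :
  bigO k f -> bigO k g -> bigO k (fun w => (f w - g w)%C).
Proof. intros; apply bigO_plus; [|apply bigO_opp]; assumption. Qed.

Lemma bigO_mult0 (k : nat) (f g : C -> C) :
  bigO 0 f -> bigO k g -> bigO k (fun w => (f w * g w)%C).
Proof. exact (bigO_mult 0 k f g). Qed.

Lemma bigO_ext (k : nat) (f g : C -> C) :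
  (forall w, f w = g w) -> bigO k f -> bigO k g.
Proof.
  intros e [B [hB H]]; exists B; split; [exact hB|].
  intros; rewrite <- e; auto.
Qed.

(** On the unit disk [f] is bounded by its own constant [B], so the factor [exp (Cmod (f w))] of the
    remainder bound is at most [exp B]. *)
Lemma bigO_exp_rem (N k : nat) (f : C -> C) :
  bigO k f -> bigO (k * N) (fun w => exp_rem N (f w)).
Proof.
  intros [B [hB H]]; exists (2 ^ N * exp B * B ^ N); split.
  - repeat apply Rmult_le_pos; try (apply pow_le; lra); left; apply exp_pos.
  - intros w hw; eapply Rle_trans; [apply exp_rem_bound|].
    specialize (H w hw).
    pose proof (Cmod_ge_0 w); pose proof (Cmod_ge_0 (f w)).
    pose proof (pow_le_1 (Cmod w) k ltac:(lra)).
    assert (h1 : Cmod (f w) ^ N <= (B * Cmod w ^ k) ^ N) by (apply pow_incr; lra).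
    rewrite Rpow_mult_distr, <- pow_mult in h1.
    assert (h2 : exp (Cmod (f w)) <= exp B).
    { assert (h : Cmod (f w) <= B) by nra.
      destruct h as [h | ->]; [left; now apply exp_increasing | lra]. }
    replace (2 ^ N * exp B * B ^ N * Cmod w ^ (k * N))
      with (2 ^ N * exp B * (B ^ N * Cmod w ^ (k * N))) by ring.
    pose proof (exp_pos (Cmod (f w))).
    apply Rmult_le_compat; auto using pow_le.
    + apply Rmult_le_pos; [apply pow_le|]; lra.
    + apply Rmult_le_compat_l; [apply pow_le; lra | exact h2].
Qed.

(** Descends through polynomial expressions in [w] to show boundedness on the unit disk; subterms of
    any other shape remain as goals. *)
Ltac bigO_bounded :=
  match goal with
  | |- bigO 0 (fun _ => ?a) => apply bigO_const
  | |- bigO 0 (fun w => w) => apply (bigO_weaken 0 1); [lia | exact bigO_id]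
  | |- bigO 0 (fun w => Cplus _ _) => apply bigO_plus; bigO_bounded
  | |- bigO 0 (fun w => Cminus _ _) => apply bigO_minus; bigO_bounded
  | |- bigO 0 (fun w => Copp _) => apply bigO_opp; bigO_bounded
  | |- bigO 0 (fun w => Cmult _ _) => apply bigO_mult0; bigO_bounded
  | |- _ => idtac
  end.

(** * The approximate characteristic root and its defect *)

Definition Ccosh (w : C) : C := ((Cexp w + Cexp (- w)%C) / 2)%C.

Lemma Cexp_taylor_rem (N : nat) (u : C) : Cexp u = (exp_taylor N u + exp_rem N u)%C.
Proof. unfold exp_rem; cring. Qed.

Lemma exp_taylor_3 (u : C) : exp_taylor 3 u = (1 + u + u * u / 2)%C.
Proof.
  simpl; replace (1 + 1) with 2 by lra.
  rewrite Rinv_1, RtoC_inv by lra; field.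
Qed.

Lemma exp_taylor_6_even (u : C) :
  (exp_taylor 6 u + exp_taylor 6 (- u) = 2 * (1 + u * u / 2 + u * u * u * u / 24))%C.
Proof.
  cbn [exp_taylor].
  change (fact 0) with 1%nat; change (fact 1) with 1%nat;
  change (fact 2) with 2%nat; change (fact 3) with 6%nat;
  change (fact 4) with 24%nat; change (fact 5) with 120%nat.
  rewrite !INR_IZR_INZ; cbn [Z.of_nat Pos.of_succ_nat Pos.succ].
  rewrite !RtoC_inv by lra; cbn [Cpow]; field.
Qed.

(** The quartic coefficient of the limit, for [v = e^(2 beta)]; it is the value that cancels the
    [w^4] term of the defect. *)
Definition kappa (v : C) : C := ((3 * v * v * v - v) / 24)%C.
Definition approx_exponent (v w : C) : C := (w * w * (v / 2 - kappa v * (w * w)))%C.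
(* [e^(-2E)] times the characteristic polynomial [X^2 - (1+q) cosh w X + q] at [X = e^E]. *)
Definition defect (v q w : C) : C :=
  (1 - (1 + q) * (Ccosh w * Cexp (- approx_exponent v w)%C)
     + q * Cexp (- 2 * approx_exponent v w)%C)%C.

Lemma bigO_approx_exponent (v : C) : bigO 2 (approx_exponent v).
Proof.
  apply bigO_ext with (fun w => ((v / 2 - kappa v * (w * w)) * (w * w))%C).
  - intro; unfold approx_exponent; ring.
  - apply bigO_mult0; [bigO_bounded | exact (bigO_mult 1 1 _ _ bigO_id bigO_id)].
Qed.

(** Since [E] is [O(w^2)], expanding its exponentials to three terms and [cosh w] through [w^4]
    leaves only remainders [O(w^6)]. In the polynomial part, the [w^2] coefficient is
    [(v - 1 - q (v + 1)) / 2], which vanishes by the choice of [q]; the [w^4] coefficient vanishes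
    by the choice of [kappa]. *)
Lemma bigO_defect (v q : C) :
  (v + 1)%C <> RtoC 0 -> q = ((v - 1) / (v + 1))%C -> bigO 6 (defect v q).
Proof.
  intros hv hq.
  pose (rc := fun w => ((exp_rem 6 w + exp_rem 6 (- w)) / 2)%C).
  pose (r1 := fun w => exp_rem 3 (- approx_exponent v w)%C).
  pose (r2 := fun w => exp_rem 3 (- 2 * approx_exponent v w)%C).
  assert (hrc : bigO 6 rc).
  { unfold rc, Cdiv.
    apply bigO_ext with (fun w => (/ 2 * (exp_rem 6 w + exp_rem 6 (- w)))%C);
      [intro; ring|].
    apply bigO_mult0; [bigO_bounded|]; apply bigO_plus.
    - exact (bigO_exp_rem 6 1 _ bigO_id).
    - exact (bigO_exp_rem 6 1 _ (bigO_opp _ _ bigO_id)). }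
  pose proof (bigO_approx_exponent v) as hE.
  assert (hr1 : bigO 6 r1) by exact (bigO_exp_rem 3 2 _ (bigO_opp _ _ hE)).
  assert (hr2 : bigO 6 r2)
    by exact (bigO_exp_rem 3 2 _ (bigO_mult0 _ _ _ (bigO_const (- 2)%C) hE)).
  assert (hE0 : bigO 0 (approx_exponent v)) by (apply (bigO_weaken 0 2); [lia | exact hE]).
  pose (k := kappa v).
  pose (A := (k + v * v / 8)%C); pose (B := (v * k / 2)%C); pose (D := (k * k / 2)%C).
  (* [w^6 Q w] is what remains of the defect when the exponentials are replaced by their
     Taylor polynomials: the coefficients of [w^2] and [w^4] cancel. *)
  pose (Q := fun w : C => (- (1 + q) * ((A / 2 - B - v / 48) + (D - B / 2 + A / 24) * (w * w)
      + (D / 2 - B / 24) * (w * w * (w * w)) + D / 24 * (w * w * (w * w) * (w * w)))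
      + q * (2 * k * k * (w * w) - 2 * v * k))%C).
  apply bigO_ext with (fun w =>
    (Q w * (w * w * (w * w) * (w * w))
     - (1 + q) * ((1 - approx_exponent v w + approx_exponent v w * approx_exponent v w / 2)
                    * rc w
                  + (1 + w * w / 2 + w * w * w * w / 24) * r1 w + rc w * r1 w)
     + q * r2 w)%C).
  - intro w; unfold defect, Ccosh.
    rewrite (Cexp_taylor_rem 6 w), (Cexp_taylor_rem 6 (- w)%C),
      (Cexp_taylor_rem 3 (- approx_exponent v w)%C),
      (Cexp_taylor_rem 3 (- 2 * approx_exponent v w)%C), !exp_taylor_3.
    fold (r1 w) (r2 w).
    replace (exp_taylor 6 w + exp_rem 6 w + (exp_taylor 6 (- w) + exp_rem 6 (- w)))%C
      with ((exp_taylor 6 w + exp_taylor 6 (- w)) + 2 * rc w)%C by (unfold rc; field).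
    rewrite exp_taylor_6_even.
    (* With the remainders made opaque, the claim is a rational identity, in which substituting [q]
       produces the cancellations. *)
    generalize (rc w) (r1 w) (r2 w); intros x y z.
    unfold Q, A, B, D, k, approx_exponent, kappa; rewrite hq; field; exact hv.
  - assert (h6 : bigO 6 (fun w : C => (w * w * (w * w) * (w * w))%C)).
    { pose proof (bigO_mult 1 1 _ _ bigO_id bigO_id) as h2.
      exact (bigO_mult 4 2 _ _ (bigO_mult 2 2 _ _ h2 h2) h2). }
    apply bigO_plus; [apply bigO_minus|].
    + apply bigO_mult0; [unfold Q; bigO_bounded | exact h6].
    + apply bigO_mult0; [bigO_bounded|].
      apply bigO_plus; [apply bigO_plus|].
      * apply bigO_mult0; [unfold Cdiv; bigO_bounded; exact hE0 | exact hrc].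
      * apply bigO_mult0; [unfold Cdiv; bigO_bounded | exact hr1].
      * apply bigO_mult0; [apply (bigO_weaken 0 6); [lia | exact hrc] | exact hr1].
    + apply bigO_mult0; [bigO_bounded | exact hr2].
Qed.

Lemma bigO_Cexp_sub_1 (k : nat) (f : C -> C) :
  bigO k f -> bigO k (fun w => (Cexp (f w) - 1)%C).
Proof.
  intro hf.
  apply bigO_ext with (fun w => exp_rem 1 (f w)).
  - intro w; unfold exp_rem; simpl; rewrite Rinv_1; cring.
  - replace k with (k * 1)%nat by lia; now apply bigO_exp_rem.
Qed.

(** * Stability of the perturbed two-term recurrence *)

(* The increments satisfy [d (m+1) = theta d m - delta r (m+1)], so they decay
   geometrically up to an error of size [delta]. *)
Lemma perturbed_recurrence (r : nat -> C) (delta theta : C) (rho eta e0 : R) (n : nat) :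
  0 <= rho < 1 -> Cmod theta <= rho -> Cmod delta <= eta -> r O = RtoC 1 ->
  Cmod (r 1%nat - r O) <= e0 ->
  (forall m, r (S (S m)) = ((1 - delta + theta) * r (S m) - theta * r m)%C) ->
  (e0 + 2 * eta * INR n) / (1 - rho) <= 1 ->
  Cmod (r n - 1) <= (e0 + 2 * eta * INR n) / (1 - rho).
Proof.
  intros hrho htheta hdelta hr0 hr1 hrec hn.
  (* [L] is the sum of the geometric series of ratio [rho]; the identity [L - rho * L = 1] closes
     both estimates of the induction. *)
  set (L := / (1 - rho)).
  assert (hL : 0 < L) by (apply Rinv_0_lt_compat; lra).
  assert (hL1 : L - rho * L = 1) by (unfold L; field; lra).
  assert (heta : 0 <= eta) by (pose proof (Cmod_ge_0 delta); lra).
  assert (he0 : 0 <= e0) by (pose proof (Cmod_ge_0 (r 1%nat - r O)); lra).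
  unfold Rdiv in *; fold L in hn |- *.
  assert (hetaL : 0 <= eta * L) by nra.
  (* The two bounds must be proved together: summing increments controls [r m - 1], and the next
     increment contains [delta * r (S m)], so it needs a bound on [r] itself. *)
  assert (H : forall m, (m <= n)%nat ->
    Cmod (r (S m) - r m) <= rho ^ m * e0 + 2 * (eta * L) /\
    Cmod (r m - 1) <= e0 * L * (1 - rho ^ m) + 2 * (eta * L) * INR m).
  { assert (bound : forall m, (m <= n)%nat ->
      e0 * L * (1 - rho ^ m) + 2 * (eta * L) * INR m <= (e0 + 2 * eta * INR n) * L).
    { intros m hm; apply le_INR in hm.
      pose proof (pow_le rho m ltac:(lra)).
      assert (0 <= e0 * L) by nra; nra. }
    induction m as [|m IH]; intros hm.
    - split; simpl; [lra|].
      rewrite hr0; replace (RtoC 1 - RtoC 1)%C with (RtoC 0) by ring.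
      rewrite Cmod_0; lra.
    - destruct IH as [hd hr]; [lia|].
      assert (hS : Cmod (r (S m) - 1) <=
                     e0 * L * (1 - rho ^ S m) + 2 * (eta * L) * INR (S m)).
      { replace (r (S m) - 1)%C with ((r (S m) - r m) + (r m - 1))%C by ring.
        eapply Rle_trans; [apply Cmod_triangle|].
        rewrite S_INR; simpl pow.
        replace (e0 * L * (1 - rho * rho ^ m))
          with (e0 * L * (1 - rho ^ m) + rho ^ m * e0 * (L - rho * L)) by ring.
        rewrite hL1; lra. }
      split; [|exact hS].
      (* The smallness hypothesis keeps [r (S m)] within distance 1 of 1; this 2 is the factor 2 in
         front of [eta]. *)
      assert (hr2 : Cmod (r (S m)) <= 2).
      { replace (r (S m)) with ((r (S m) - 1) + 1)%C by ring.
        eapply Rle_trans; [apply Cmod_triangle|].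
        rewrite Cmod_1; specialize (bound (S m) hm); lra. }
      replace (r (S (S m)) - r (S m))%C
        with (theta * (r (S m) - r m) + - (delta * r (S m)))%C by (rewrite hrec; ring).
      eapply Rle_trans; [apply Cmod_triangle|].
      rewrite Cmod_opp, !Cmod_mult.
      assert (Cmod theta * Cmod (r (S m) - r m) <= rho * (rho ^ m * e0 + 2 * (eta * L)))
        by (apply Rmult_le_compat; auto using Cmod_ge_0).
      assert (Cmod delta * Cmod (r (S m)) <= eta * 2)
        by (apply Rmult_le_compat; auto using Cmod_ge_0).
      replace (rho ^ S m * e0 + 2 * (eta * L))
        with (rho * (rho ^ m * e0 + 2 * (eta * L)) + 2 * eta * (L - rho * L)) by (simpl; ring).
      rewrite hL1; lra. }
  destruct (H n (le_n n)) as [_ h].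
  pose proof (pow_le rho n ltac:(lra)).
  assert (0 <= e0 * L) by nra.
  nra.
Qed.

(** * The transfer matrix and the recurrence for the moment generating function *)

Lemma Cscale_Cmult (x : R) (u : C) : Cscale x u = (RtoC x * u)%C.
Proof. apply injective_projections; simpl; ring. Qed.

Lemma Csum_cons_spins (f : list R -> C) (l : list (list R)) :
  Csum (map f (flat_map (fun s => (1 :: s) :: (-1 :: s) :: nil) l))
  = (Csum (map (fun s => f (1 :: s)) l) + Csum (map (fun s => f (-1 :: s)) l))%C.
Proof.
  induction l as [|s l IH]; simpl.
  - change (Defs.RtoC 0) with (RtoC 0); cring.
  - rewrite IH; change Cadd with Cplus.
    generalize (Csum (map (fun s => f (1 :: s)) l) : C),
      (Csum (map (fun s => f (-1 :: s)) l) : C).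
    intros; cring.
Qed.

Lemma Csum_mult_l {T : Type} (c : C) (f : T -> C) (l : list T) :
  Csum (map (fun s => (c * f s)%C) l) = (c * Csum (map f l))%C.
Proof.
  induction l as [|s l IH]; simpl.
  - change (Defs.RtoC 0) with (RtoC 0); cring.
  - rewrite IH; change Cadd with Cplus; generalize (Csum (map f l) : C).
    intros; cring.
Qed.

Definition tilted_weight (beta : R) (w : C) (s : list R) : C :=
  (RtoC (ising_weight beta s) * Cexp (RtoC (magnet s) * w)%C)%C.

Definition tilted_partition (beta : R) (n : nat) (w : C) : C :=
  Csum (map (tilted_weight beta w) (configs n)).

(* Partition function of the chain of length [m + 1] with first spin [x]. *)
Definition pinned_partition (beta x : R) (m : nat) (w : C) : C :=
  Csum (map (fun s => tilted_weight beta w (x :: s)) (configs m)).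

Lemma tilted_partition_S (beta : R) (m : nat) (w : C) :
  tilted_partition beta (S m) w
  = (pinned_partition beta 1 m w + pinned_partition beta (-1) m w)%C.
Proof. apply Csum_cons_spins. Qed.

Lemma tilted_weight_cons2 (beta x y : R) (w : C) (s : list R) :
  tilted_weight beta w (x :: y :: s)
  = (RtoC (exp (beta * (x * y))) * Cexp (RtoC x * w)%C * tilted_weight beta w (y :: s))%C.
Proof.
  unfold tilted_weight, ising_weight.
  change (interaction (x :: y :: s)) with (x * y + interaction (y :: s)).
  change (magnet (x :: y :: s)) with (x + magnet (y :: s)).
  rewrite Rmult_plus_distr_l, exp_plus, RtoC_mult, RtoC_plus, Cmult_plus_distr_r, Cexp_add.
  cring.
Qed.

Lemma pinned_partition_0 (beta x : R) (w : C) :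
  pinned_partition beta x 0 w = Cexp (RtoC x * w)%C.
Proof.
  unfold pinned_partition, tilted_weight, ising_weight; simpl.
  rewrite Rmult_0_r, exp_0, Rplus_0_r.
  change Cadd with Cplus; change (Defs.RtoC 0) with (RtoC 0); cring.
Qed.

(** One application of the transfer matrix, with entries [e^(x w) e^(beta x y)]: the configurations
    are split by the second spin [y]. *)
Lemma pinned_partition_S (beta x : R) (m : nat) (w : C) :
  pinned_partition beta x (S m) w
  = (Cexp (RtoC x * w)%C *
     (RtoC (exp (beta * x)) * pinned_partition beta 1 m w
      + RtoC (exp (- beta * x)) * pinned_partition beta (-1) m w))%C.
Proof.
  unfold pinned_partition at 1; simpl configs; rewrite Csum_cons_spins.
  rewrite (map_ext _ _ (fun s => tilted_weight_cons2 beta x 1 w s)).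
  rewrite (map_ext _ _ (fun s => tilted_weight_cons2 beta x (-1) w s)).
  rewrite !Csum_mult_l.
  fold (pinned_partition beta 1 m w) (pinned_partition beta (-1) m w).
  replace (beta * (x * 1)) with (beta * x) by ring.
  replace (beta * (x * -1)) with (- beta * x) by ring.
  cring.
Qed.

Lemma ising_Z_tilted (beta : R) (n : nat) :
  RtoC (ising_Z beta n) = tilted_partition beta n 0.
Proof.
  assert (h : forall s, tilted_weight beta 0 s = RtoC (ising_weight beta s)).
  { intro s; unfold tilted_weight; rewrite Cmult_0_r, Cexp_0; ring. }
  unfold ising_Z, tilted_partition; induction (configs n) as [|s l IH]; [reflexivity|].
  simpl; rewrite RtoC_plus, IH, h; reflexivity.
Qed.

(** At [w = 0] both columns of the transfer matrix sum to [e^beta + e^(-beta)], so each added spin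
    multiplies the total by this number. *)
Lemma ising_Z_S (beta : R) (m : nat) :
  RtoC (ising_Z beta (S m)) = (2 * RtoC (exp beta + exp (- beta)) ^ m)%C.
Proof.
  rewrite ising_Z_tilted, tilted_partition_S.
  induction m as [|m IH].
  - rewrite !pinned_partition_0, !Cmult_0_r, Cexp_0; simpl; ring.
  - rewrite !pinned_partition_S, !Cmult_0_r, Cexp_0.
    replace (beta * 1) with beta by ring; replace (- beta * 1) with (- beta) by ring.
    replace (beta * -1) with (- beta) by ring; replace (- beta * -1) with beta by ring.
    rewrite Cpow_S, RtoC_plus.
    transitivity ((RtoC (exp beta) + RtoC (exp (- beta))) *
      (pinned_partition beta 1 m 0 + pinned_partition beta (-1) m 0))%C; [ring|].
    rewrite IH, RtoC_plus; ring.
Qed.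

Lemma ising_mgf_tilted (beta : R) (n : nat) (w : C) :
  ising_mgf beta n w = (RtoC (/ ising_Z beta n) * tilted_partition beta n w)%C.
Proof.
  unfold ising_mgf, tilted_partition; rewrite <- Csum_mult_l; f_equal.
  apply map_ext; intro s; unfold tilted_weight.
  rewrite !Cscale_Cmult; unfold Rdiv; rewrite RtoC_mult; cring.
Qed.

Lemma ising_mgf_0 (beta : R) (w : C) : ising_mgf beta 0 w = RtoC 1.
Proof.
  rewrite ising_mgf_tilted.
  unfold ising_Z, tilted_partition, tilted_weight, ising_weight; simpl.
  rewrite Rmult_0_r, exp_0, Rplus_0_r, Rinv_1, Cmult_0_l, Cexp_0.
  change Cadd with Cplus; change (Defs.RtoC 0) with (RtoC 0); cring.
Qed.

Lemma ising_mgf_1 (beta : R) (w : C) : ising_mgf beta 1 w = Ccosh w.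
Proof.
  assert (h : ising_Z beta 1 = 2).
  { apply RtoC_inj; rewrite ising_Z_S; simpl; ring. }
  rewrite ising_mgf_tilted, h, tilted_partition_S, !pinned_partition_0, RtoC_inv by lra.
  unfold Ccosh; replace (RtoC 1 * w)%C with w by ring.
  replace (RtoC (-1) * w)%C with (- w)%C by ring.
  unfold Cdiv; cring.
Qed.

(** Cayley-Hamilton for the transfer matrix. With [a = e^beta], its trace is [2 a cosh w] and its
    determinant [a^2 - a^(-2)]; dividing them by [a + 1/a] and its square, the growth of the
    normalization, gives [(1+q) cosh w] and [q]. *)
Lemma ising_mgf_rec (beta : R) (n : nat) (w : C) :
  let v := RtoC (exp (2 * beta)) in
  let q := ((v - 1) / (v + 1))%C in
  ising_mgf beta (S (S n)) w
  = ((1 + q) * Ccosh w * ising_mgf beta (S n) w - q * ising_mgf beta n w)%C.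
Proof.
  intros v q.
  pose (a := RtoC (exp beta)).
  pose proof (exp_pos beta) as ha; pose proof (exp_pos (- beta)) as hb.
  assert (ha0 : a <> RtoC 0) by (unfold a; intro h; apply RtoC_inj in h; lra).
  assert (hs : (a * a + 1)%C <> RtoC 0).
  { unfold a; rewrite <- RtoC_mult, <- RtoC_plus; intro h; apply RtoC_inj in h; nra. }
  assert (hab : RtoC (exp (- beta)) = (/ a)%C).
  { unfold a; rewrite exp_Ropp, RtoC_inv by lra; reflexivity. }
  assert (hv : v = (a * a)%C).
  { unfold v, a; rewrite <- RtoC_mult, <- exp_plus; do 2 f_equal; ring. }
  assert (hsum : RtoC (exp beta + exp (- beta)) = ((a * a + 1) / a)%C).
  { rewrite RtoC_plus, hab; fold a; field; exact ha0. }
  assert (hsum0 : ((a * a + 1) / a)%C <> RtoC 0).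
  { rewrite <- hsum; intro h; apply RtoC_inj in h; lra. }
  assert (hw1 : (RtoC 1 * w)%C = w) by ring.
  assert (hw2 : (RtoC (-1) * w)%C = (- w)%C) by ring.
  assert (hstep : forall m,
    pinned_partition beta 1 (S m) w
    = (Cexp w * (a * pinned_partition beta 1 m w + / a * pinned_partition beta (-1) m w))%C
    /\ pinned_partition beta (-1) (S m) w
    = (Cexp (- w)%C * (/ a * pinned_partition beta 1 m w + a * pinned_partition beta (-1) m w))%C).
  { intro m; rewrite !pinned_partition_S, hw1, hw2.
    replace (beta * 1) with beta by ring; replace (- beta * 1) with (- beta) by ring.
    replace (beta * -1) with (- beta) by ring; replace (- beta * -1) with beta by ring.
    rewrite hab; split; reflexivity. }
  pose proof (Cexp_opp w) as hE.
  assert (hZ : forall m, RtoC (/ ising_Z beta (S m)) = (/ (2 * ((a * a + 1) / a) ^ m))%C).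
  { intro m; rewrite <- hsum, <- ising_Z_S, RtoC_inv; [reflexivity|].
    intro h; pose proof (ising_Z_S beta m) as h'; rewrite h in h'.
    symmetry in h'; revert h'; apply Cmult_neq_0.
    - intro h'; apply RtoC_inj in h'; lra.
    - apply Cpow_nz; now rewrite hsum. }
  unfold q; rewrite hv; clear q v hv; as_C_eq.
  rewrite ising_mgf_tilted, hZ, tilted_partition_S.
  destruct (hstep n) as [-> ->].
  set (x := Cexp w : C) in *; set (y := Cexp (- w)%C : C) in *.
  unfold Ccosh; fold x y.
  destruct n as [|n].
  (* The empty chain has no first spin to pin, so the recurrence starting from length 0 is checked
     directly. As [field] treats [x] and [y] as independent, [x * y] stays explicit until [hE] turns
     it into 1. *)
  - rewrite ising_mgf_0, ising_mgf_1, !pinned_partition_0, hw1, hw2; unfold Ccosh; fold x y.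
    transitivity ((1 + (a * a - 1) / (a * a + 1)) * ((x + y) / 2) * ((x + y) / 2)
                  - (a * a - 1) / (a * a + 1) * (x * y))%C.
    + simpl Cpow; field; split; assumption.
    + rewrite hE; reflexivity.
  - rewrite !ising_mgf_tilted, !hZ, !tilted_partition_S.
    destruct (hstep n) as [-> ->].
    pose proof (Cpow_nz _ n hsum0) as hG; rewrite !Cpow_S.
    set (G := (((a * a + 1) / a) ^ n)%C) in *.
    generalize (pinned_partition beta 1 n w) (pinned_partition beta (-1) n w); intros P M.
    set (P' := (x * (a * P + / a * M))%C); set (M' := (y * (/ a * P + a * M))%C).
    transitivity (/ (2 * ((a * a + 1) / a * ((a * a + 1) / a * G)))
      * (a * (x + y) * (P' + M') - (a - / a) * (a + / a) * (x * y) * (P + M)))%C.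
    + unfold P', M'; field; repeat split; assumption.
    + rewrite hE; generalize P' M'; intros; field; repeat split; assumption.
Qed.

(** * Asymptotics of the moment generating function for small argument *)

Lemma Cexp_pow (u : C) (n : nat) : (Cexp u ^ n)%C = Cexp (RtoC (INR n) * u)%C.
Proof.
  induction n as [|n IH].
  - simpl; now rewrite Cmult_0_l, Cexp_0.
  - rewrite Cpow_S, IH, <- Cexp_add, S_INR, RtoC_plus; f_equal; cring.
Qed.

(** The region [n |w|^4 <= K^4] is that of [w = z / n^(1/4)] with [|z| <= K]. There
    [n |w|^6 <= K^4 |w|^2], so the accumulated defect is absorbed into [O(w)]. *)
Lemma ising_mgf_asymptotics (beta K : R) :
  0 <= beta -> 0 <= K ->
  let v := RtoC (exp (2 * beta)) in
  exists D w0, 0 <= D /\ 0 < w0 /\ forall (n : nat) (w : C),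
    Cmod w <= w0 -> INR n * Cmod w ^ 4 <= K ^ 4 ->
    Cmod (ising_mgf beta n w * Cexp (RtoC (INR n) * (- approx_exponent v w))%C - 1)
      <= D * Cmod w.
Proof.
  intros hbeta hK v.
  set (x := exp (2 * beta)) in *.
  assert (hx : 1 <= x).
  { unfold x; rewrite <- exp_0.
    destruct (Rle_lt_or_eq_dec _ _ hbeta) as [h | <-].
    - left; apply exp_increasing; lra.
    - rewrite Rmult_0_r; lra. }
  assert (hv : (v + 1)%C <> RtoC 0).
  { unfold v; rewrite <- RtoC_plus; intro h; apply RtoC_inj in h; lra. }
  set (q := ((v - 1) / (v + 1))%C).
  set (t := (x - 1) / (x + 1)).
  assert (ht : 0 <= t < 1).
  { unfold t; split.
    - apply Rdiv_le_0_compat; lra.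
    - apply Rmult_lt_reg_r with (x + 1); [lra|].
      unfold Rdiv; rewrite Rmult_assoc, Rinv_l; lra. }
  assert (hq : q = RtoC t).
  { unfold q, t, v; rewrite RtoC_div, RtoC_minus, RtoC_plus by lra; reflexivity. }
  pose proof (bigO_approx_exponent v) as hE.
  destruct (bigO_defect v q hv eq_refl) as [B [hB HB]].
  destruct (bigO_weaken 1 2 _ ltac:(lia)
    (bigO_Cexp_sub_1 2 _ (bigO_mult0 _ _ _ (bigO_const (- 2)%C) hE))) as [B1 [hB1 HB1]].
  assert (h0 : bigO 1 (fun w => (Ccosh w * Cexp (- approx_exponent v w)%C - 1)%C)).
  { pose proof (bigO_Cexp_sub_1 1 _ bigO_id) as h1.
    pose proof (bigO_Cexp_sub_1 1 _ (bigO_opp _ _ bigO_id)) as h2.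
    pose proof (bigO_weaken 1 2 _ ltac:(lia) (bigO_Cexp_sub_1 2 _ (bigO_opp _ _ hE))) as h3.
    assert (h4 : bigO 1 (fun w => (Ccosh w - 1)%C)).
    { apply bigO_ext with (fun w => (/ 2 * ((Cexp w - 1) + (Cexp (- w)%C - 1)))%C).
      - intro w; unfold Ccosh; field.
      - apply bigO_mult0; [apply bigO_const | apply bigO_plus; assumption]. }
    apply bigO_ext with (fun w => ((Ccosh w - 1)
      + (1 + (Ccosh w - 1)) * (Cexp (- approx_exponent v w)%C - 1))%C).
    - intro w; cring.
    - apply bigO_plus; [exact h4|].
      apply bigO_mult0; [|exact h3].
      apply bigO_plus; [apply bigO_const | apply (bigO_weaken 0 1); [lia | exact h4]]. }
  destruct h0 as [B0 [hB0 HB0]].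
  (* Midpoint between [t = tanh beta] and 1, leaving room for the factor [e^(-2E)] in [theta]. *)
  set (rho := (1 + t) / 2).
  set (D := (B0 + 2 * B * K ^ 4) / (1 - rho)).
  assert (hrho : 0 <= rho < 1) by (unfold rho; lra).
  assert (hK4 : 0 <= K ^ 4) by now apply pow_le.
  assert (hD : 0 <= D).
  { unfold D; apply Rdiv_le_0_compat; [|lra].
    pose proof (Rmult_le_pos _ _ hB hK4); lra. }
  (* The three summands ensure, for [|w| <= 1/T], that [|w| <= 1], that [D |w| <= 1] (the smallness
     condition of [perturbed_recurrence]), and that [B1 |w| <= 1 - rho]. *)
  set (T := 1 + D + B1 / (1 - rho)).
  assert (hB1r : 0 <= B1 / (1 - rho)) by (apply Rdiv_le_0_compat; lra).
  assert (hT : 1 <= T) by (unfold T; lra).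
  exists D, (/ T); split; [exact hD|]; split; [apply Rinv_0_lt_compat; lra|].
  intros n w hw hn.
  pose proof (Cmod_ge_0 w) as hw0.
  assert (hwT : Cmod w * T <= 1).
  { apply Rmult_le_compat_r with (r := T) in hw; [|lra].
    rewrite Rinv_l in hw; lra. }
  assert (hw1 : Cmod w <= 1) by nra.
  assert (hwD : D * Cmod w <= 1) by (unfold T in hwT; nra).
  assert (hwB : B1 * Cmod w <= 1 - rho).
  { replace (B1 * Cmod w) with (Cmod w * (B1 / (1 - rho)) * (1 - rho)) by (field; lra).
    unfold T in hwT; assert (Cmod w * (B1 / (1 - rho)) <= 1) by nra; nra. }
  specialize (HB w hw1); specialize (HB0 w hw1); specialize (HB1 w hw1); simpl in HB0, HB1.
  rewrite Rmult_1_r in HB0, HB1.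
  set (E := approx_exponent v w) in *.
  set (theta := (q * Cexp (- 2 * E)%C)%C).
  assert (htheta : Cmod theta <= rho).
  { unfold theta; rewrite Cmod_mult, hq, Cmod_R, Rabs_pos_eq by lra.
    assert (Cmod (Cexp (- 2 * E)%C) <= 1 + (1 - rho)).
    { replace (Cexp (- 2 * E)%C : C) with (1 + (Cexp (- 2 * E)%C - 1))%C by cring.
      eapply Rle_trans; [apply Cmod_triangle|]; rewrite Cmod_1; lra. }
    (* The inequality [t (2 - rho) <= rho] amounts to [(1 - t)^2 >= 0]. *)
    unfold rho in *; nra. }
  set (r := fun m => (ising_mgf beta m w * Cexp (- E)%C ^ m)%C).
  assert (hn6 : B0 * Cmod w + 2 * (B * Cmod w ^ 6) * INR n
                  <= (B0 + 2 * B * K ^ 4) * Cmod w).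
  { replace (2 * (B * Cmod w ^ 6) * INR n)
      with (2 * B * (INR n * Cmod w ^ 4 * (Cmod w * Cmod w))) by ring.
    assert (INR n * Cmod w ^ 4 * (Cmod w * Cmod w) <= K ^ 4 * Cmod w).
    { apply Rmult_le_compat; [|nra|exact hn|nra].
      apply Rmult_le_pos; [apply pos_INR | now apply pow_le]. }
    nra. }
  assert (hfin : (B0 * Cmod w + 2 * (B * Cmod w ^ 6) * INR n) / (1 - rho) <= D * Cmod w).
  { unfold D, Rdiv.
    replace ((B0 + 2 * B * K ^ 4) * / (1 - rho) * Cmod w)
      with ((B0 + 2 * B * K ^ 4) * Cmod w * / (1 - rho)) by ring.
    apply Rmult_le_compat_r; [left; apply Rinv_0_lt_compat; lra | exact hn6]. }
  rewrite <- Cexp_pow; change (Cmod (r n - 1) <= D * Cmod w).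
  eapply Rle_trans; [|exact hfin].
  apply (perturbed_recurrence r (defect v q w) theta).
  - exact hrho.
  - exact htheta.
  - exact HB.
  - unfold r; rewrite ising_mgf_0; simpl; ring.
  - replace (r 1%nat - r O)%C with (Ccosh w * Cexp (- E)%C - 1)%C; [exact HB0|].
    unfold r; rewrite ising_mgf_0, ising_mgf_1; simpl; cring.
  (* By the definition of [defect], [1 - delta + theta] is exactly [(1+q) cosh w e^(-E)]. *)
  - intro m; unfold r; rewrite ising_mgf_rec; fold x; fold v; fold q.
    unfold defect, theta; fold E.
    replace (Cexp (- 2 * E)%C) with (Cexp (- E)%C * Cexp (- E)%C)%C
      by (rewrite <- Cexp_add; f_equal; ring).
    rewrite !Cpow_S.
    generalize (ising_mgf beta (S m) w : C) (ising_mgf beta m w : C).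
    intros; cring.
  - lra.
Qed.

(** * Rescaling and convergence to the limiting function *)

Lemma Rpower_quarter (y : R) :
  0 < y -> Rpower y (1 / 4) ^ 4 = y /\ Rpower y (1 / 2) = Rpower y (1 / 4) ^ 2.
Proof.
  intro hy; split; rewrite <- Rpower_pow by apply exp_pos; rewrite Rpower_mult.
  - replace (1 / 4 * INR 4) with 1 by (simpl; field); now apply Rpower_1.
  - f_equal; simpl; field.
Qed.

Lemma kappa_RtoC (beta : R) :
  kappa (RtoC (exp (2 * beta))) = RtoC ((3 * exp (6 * beta) - exp (2 * beta)) / 24).
Proof.
  replace (6 * beta) with (2 * beta + 2 * beta + 2 * beta) by ring.
  rewrite !exp_plus, RtoC_div, RtoC_minus, !RtoC_mult by lra.
  unfold kappa; field.
Qed.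

Lemma psi_lim_kappa (beta : R) (z : C) :
  psi_lim beta z = Cexp (- kappa (RtoC (exp (2 * beta))) * (z * z * (z * z)))%C.
Proof.
  unfold psi_lim; f_equal; rewrite Cscale_Cmult, kappa_RtoC, <- RtoC_opp.
  change Cmul with Cmult; f_equal; f_equal; field.
Qed.

(** The Gaussian factor equals [e^(-nE)] times the limit, since [n = y^4] for [y = n^(1/4)]. This
    excludes [n = 0], where [Rpower], being an exponential, is still positive. *)
Lemma modgauss_term_normalized (beta : R) (n : nat) (z : C) :
  (1 <= n)%nat ->
  let v := RtoC (exp (2 * beta)) in
  let w := (RtoC (/ Rpower (INR n) (1 / 4)) * z)%C in
  modgauss_term beta n z
  = (ising_mgf beta n w * Cexp (RtoC (INR n) * (- approx_exponent v w))%C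
     * psi_lim beta z)%C.
Proof.
  intros hn v w.
  assert (hn0 : 0 < INR n) by (apply lt_0_INR; lia).
  destruct (Rpower_quarter _ hn0) as [h4 h2].
  unfold modgauss_term; rewrite !Cscale_Cmult, psi_lim_kappa, h2; fold v.
  change Cmul with Cmult; rewrite <- Cmult_assoc, <- Cexp_add; unfold w; f_equal; f_equal.
  assert (hy : 0 < Rpower (INR n) (1 / 4)) by apply exp_pos.
  revert h4 hy; generalize (Rpower (INR n) (1 / 4)); intros y h4 hy.
  rewrite <- h4.
  rewrite RtoC_inv, RtoC_pow, RtoC_div, RtoC_opp, RtoC_mult, RtoC_pow by lra; fold v.
  unfold approx_exponent; simpl Cpow.
  assert (hyC : RtoC y <> RtoC 0) by (intro h; apply RtoC_inj in h; lra).
  field; exact hyC.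
Qed.

Lemma modgauss_converges (beta : R) (hbeta : 0 <= beta) (K eps : R) :
  0 <= K -> 0 < eps ->
  exists N : nat, forall (n : nat) (z : C),
    (N <= n)%nat -> Cmod z <= K -> Cmod (modgauss_term beta n z - psi_lim beta z) < eps.
Proof.
  intros hK heps.
  destruct (ising_mgf_asymptotics beta K hbeta hK) as [D [w0 [hD [hw0 H]]]].
  set (v := RtoC (exp (2 * beta))) in *.
  set (M := exp (Cmod (kappa v) * K ^ 4)).
  assert (hM : 0 < M) by apply exp_pos.
  assert (hDM : 0 <= D * M) by nra.
  (* Target size for [|w|]: within the range of the asymptotics, and with [D * tau * M < eps], where
     [M] bounds the limit on the disk. The added 1 makes this strict and the denominator
     positive. *)
  set (tau := Rmin w0 (eps / (1 + D * M))).
  assert (htau : 0 < tau).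
  { apply Rmin_glb_lt; [exact hw0 | apply Rdiv_lt_0_compat; lra]. }
  assert (htau1 : tau * (1 + D * M) <= eps).
  { replace eps with (eps / (1 + D * M) * (1 + D * M)) by (field; lra).
    apply Rmult_le_compat_r; [lra | apply Rmin_r]. }
  (* Once [n^(1/4) >= T], [|w| <= K / T <= tau]; the added 1 keeps [T] positive when [K = 0]. *)
  set (T := K / tau + 1).
  assert (hT : 0 < T) by (pose proof (Rdiv_le_0_compat K tau hK htau); unfold T; lra).
  destruct (INR_unbounded (T ^ 4)) as [N hN].
  exists (S N); intros n z hn hz.
  assert (hn1 : INR N <= INR n) by (apply le_INR; lia).
  assert (hn0 : 0 < INR n) by (apply lt_0_INR; lia).
  rewrite modgauss_term_normalized by lia; fold v.
  destruct (Rpower_quarter _ hn0) as [h4 _].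
  assert (hy : 0 < Rpower (INR n) (1 / 4)) by apply exp_pos.
  set (y := Rpower (INR n) (1 / 4)) in *.
  set (w := (RtoC (/ y) * z)%C).
  assert (hTy : T <= y).
  { destruct (Rle_lt_dec T y) as [h | h]; [exact h|].
    assert (y ^ 4 <= T ^ 4) by (apply pow_incr; lra); lra. }
  pose proof (Cmod_ge_0 z) as hz0.
  assert (hw : Cmod w = / y * Cmod z).
  { unfold w; rewrite Cmod_mult, Cmod_R, Rabs_pos_eq; [reflexivity|].
    left; now apply Rinv_0_lt_compat. }
  assert (hwtau : Cmod w <= tau).
  { rewrite hw; apply Rmult_le_reg_l with y; [exact hy|].
    rewrite <- Rmult_assoc, Rinv_r, Rmult_1_l by lra.
    assert (K = K / tau * tau) by (field; lra).
    unfold T in hTy; nra. }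
  assert (hw4 : INR n * Cmod w ^ 4 <= K ^ 4).
  { rewrite <- h4, hw, Rpow_mult_distr, <- Rmult_assoc, <- Rpow_mult_distr,
      Rinv_r, pow1, Rmult_1_l by lra.
    apply pow_incr; lra. }
  assert (hpsi : Cmod (psi_lim beta z) <= M).
  { rewrite psi_lim_kappa; fold v; eapply Rle_trans; [apply Cmod_Cexp_le|].
    unfold M; rewrite !Cmod_mult, Cmod_opp.
    assert (h : Cmod (kappa v) * (Cmod z * Cmod z * (Cmod z * Cmod z))
                  <= Cmod (kappa v) * K ^ 4).
    { apply Rmult_le_compat_l; [apply Cmod_ge_0|].
      replace (Cmod z * Cmod z * (Cmod z * Cmod z)) with (Cmod z ^ 4) by ring.
      apply pow_incr; lra. }
    destruct h as [h | ->]; [left; now apply exp_increasing | lra]. }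
  assert (hr := H n w (Rle_trans _ _ _ hwtau (Rmin_l _ _)) hw4).
  revert hr; set (r := (ising_mgf beta n w * _)%C); intro hr.
  replace (r * psi_lim beta z - psi_lim beta z)%C with ((r - 1) * psi_lim beta z)%C
    by (generalize (psi_lim beta z : C); intro; ring).
  rewrite Cmod_mult.
  assert (Cmod (r - 1) * Cmod (psi_lim beta z) <= D * tau * M).
  { apply Rmult_le_compat; auto using Cmod_ge_0.
    eapply Rle_trans; [exact hr|]; now apply Rmult_le_compat_l. }
  nra.
Qed.

(* From here on [Cmod] is again the modulus of [Defs], not Coquelicot's. *)
Import Pilot.Defs.

(* Locally uniform convergence on compacts of C, stated as uniform convergence
   on every closed disk |z| <= K (every compact set lies in such a disk). *)
Theorem theorem2p2 (beta : R) (hbeta : 0 <= beta) :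
  forall K eps : R, 0 < eps ->
  exists N : nat, forall (n : nat) (z : Cpx),
    (N <= n)%nat -> Cmod z <= K ->
    Cmod (Csub (modgauss_term beta n z) (psi_lim beta z)) < eps.
Proof.
  intros K eps heps.
  destruct (Rle_lt_dec 0 K) as [hK | hK].
  - exact (modgauss_converges beta hbeta K eps hK heps).
  (* A disk of negative radius is empty. *)
  - exists O; intros n z _ hz.
    exfalso; pose proof (sqrt_pos (fst z ^ 2 + snd z ^ 2)); unfold Cmod in hz; lra.
Qed.
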